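(* Let $X\subseteq\mathbb{R}^2$ be a set with $n$ one-point holes $q_1,q_2,\dots,q_n$ in clockwise convex position. Then \[ n\le T_2(\chi(X)). \]
   Context: For $X\subseteq\mathbb{R}^d$, two points of $X$ see each other if the segment joining them is contained in $X$; $\chi(X)$ is the chromatic number of the invisibility graph $I(X)$, whose vertex set is $X$ and in which two points are adjacent if and only if they do not see each other. A one-point hole in $X$ is a point that forms a path-connected component of $\mathbb{R}^d\setminus X$. Points $q_1,\dots,q_n$ in the plane are in clockwise convex position if they form the vertices of a convex polygon in the clockwise order (in particular no three are collinear). The tower function is defined by $T_0(k)=k$, $T_h(k)=2^{T_{h-1}(k)}$, so $T_2(k)=2^{2^k}$; if $\chi(X)$ is infinite the bound is understood as $\infty$, so the inequality is vacuous. *)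

(* Defs.v *)
From HB Require Import structures.
From mathcomp Require Import all_boot all_order all_algebra.
From mathcomp Require Import all_classical all_reals all_analysis.

Set Implicit Arguments.
Unset Strict Implicit.
Unset Printing Implicit Defensive.

Import Order.TTheory GRing.Theory Num.Theory.
Import numFieldNormedType.Exports.

Local Open Scope classical_set_scope.
Local Open Scope ring_scope.

Definition colorable (V : Type) (adj : V -> V -> Prop) (k : nat) : Prop :=
  exists c : V -> 'I_k, forall x y, adj x y -> c x <> c y.

(* [None] stands for an infinite chromatic number: no finite set of colours
   suffices. *)
Definition chromatic_number (V : Type) (adj : V -> V -> Prop) : option nat :=
  if pselect (exists k, `[< colorable adj k >]) is left h
  then Some (ex_minn h) else None.

Definition segment (R : realType) (d : nat) (x y : 'rV[R]_d) : set 'rV[R]_d :=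
  [set (1 - t) *: x + t *: y | t in `[0, 1]%classic].

Definition sees (R : realType) (d : nat) (X : set 'rV[R]_d) (x y : 'rV[R]_d) :
  Prop := segment x y `<=` X.

Definition invisible (R : realType) (d : nat) (X : set 'rV[R]_d) (x y : X) :
  Prop := ~ sees X (val x) (val y).

Definition chi (R : realType) (d : nat) (X : set 'rV[R]_d) : option nat :=
  chromatic_number (@invisible R d X).

(* The path-connected component of [x] in [A]; it is empty when [x] is not
   in [A]. *)
Definition path_component (T : topologicalType) (R : realType) (A : set T)
    (x : T) : set T :=
  [set y | exists g : R -> T,
    [/\ {within `[0, 1], continuous g}, g @` `[0, 1] `<=` A,
        g 0 = x & g 1 = y]].

Definition one_point_hole (R : realType) (d : nat) (X : set 'rV[R]_d)
    (q : 'rV[R]_d) : Prop :=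
  path_component R (~` X) q = [set q].

(* Twice the signed area of the triangle [a b c]; negative exactly when
   [a], [b], [c] make a strict right (clockwise) turn. *)
Definition orientation (R : realType) (a b c : 'rV[R]_2) : R :=
  (b 0 0 - a 0 0) * (c 0 1 - a 0 1) - (b 0 1 - a 0 1) * (c 0 0 - a 0 0).

(* The closed polygon [q_0 q_1 ... q_(n-1)] is convex and traversed clockwise:
   every vertex other than the two ends of the directed edge from [q_i] to its
   cyclic successor lies strictly to the right of that edge.  The second clause
   is void for [n <= 2], where only distinctness is required. *)
Definition clockwise_convex_position (R : realType) (n : nat)
    (q : 'I_n -> 'rV[R]_2) : Prop :=
  injective q /\
  forall i j : 'I_n, j != i -> j != ordS i ->
    orientation (q i) (q (ordS i)) (q j) < 0.

Fixpoint tower (h k : nat) : nat :=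
  if h is h'.+1 then (2 ^ tower h' k)%N else k.

(* Order between a natural number and a possibly infinite one. *)
Definition leq_ext (n : nat) (m : option nat) : bool :=
  if m is Some k then (n <= k)%N else true.

(* Main.v *)
Require Import Defs.
From mathcomp Require Import all_boot all_order all_algebra.
From mathcomp Require Import all_classical all_reals all_analysis.
From mathcomp Require Import zify ring lra.

(** The proof exhibits a shift graph on triples inside the invisibility graph.

    Suppose [X] is coloured properly with [k] colours.  Points of [X] lying on
    one line and separated pairwise by points outside [X] have distinct
    colours, so [X] meets a line in boundedly many intervals.  A one-point hole
    [q] is a limit of points of [X] along every ray from [q], since otherwise
    the path component of [q] would contain a segment.  Together, every ray
    from a hole starts with an open interval contained in [X]
    ([hole_ray_near]): near the holes, [X] looks like a punctured disc as far
    as finitely many rays are concerned.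

    Next choose, for [j < l], a line through [q_l] with direction [v j l] that
    passes very close to [q_j], just to the left of it when looking from [q_j]
    to [q_l].  As the holes are in clockwise convex position, for each [i < j]
    the ray leaving [q_j] in the direction [v i j], which is almost the
    direction from [q_i] to [q_j], points to that same left side, so the line
    meets it very near [q_j], hence in [X].  Call the meeting point [p i j l].
    Both [p i j l] and [p j l m] lie on the line through [q_l] directed by
    [v j l], the first before [q_l] and the second beyond it; since [q_l] is
    not in [X] they do not see each other.

    So [(i, j, l)] and [(j, l, m)] receive different colours whenever
    [i < j < l < m].  Passing to the set of colours of all triples that extend
    a pair, and then to the family of sets of all pairs that extend an index,
    gives distinct families to distinct indices ([card_shift_triple]), and
    there are [2 ^ 2 ^ k] families of colours. *)

Set Implicit Arguments.
Unset Strict Implicit.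
Unset Printing Implicit Defensive.

Import Order.TTheory GRing.Theory Num.Theory.
Import numFieldNormedType.Exports.

Local Open Scope classical_set_scope.
Local Open Scope ring_scope.

(** * Shift graphs *)

Section ShiftGraphs.

Lemma card_sets (T : finType) : #|{set T}| = (2 ^ #|T|)%N.
Proof.
rewrite -(cardsT T) -card_powerset; apply: eq_card => A.
by rewrite !inE finset.subsetT.
Qed.

(** Record for each vertex the colours of the arcs leaving it.  If [i < j],
    the colour of the arc [(i, j)] leaves [i] and cannot leave [j], so the
    recorded sets are distinct. *)
Lemma card_shift_pair (n : nat) (T : finType) (f : 'I_n -> 'I_n -> T) :
  (forall i j l : 'I_n, (i < j)%N -> (j < l)%N -> f i j <> f j l) ->
  (n <= 2 ^ #|T|)%N.
Proof.
move=> f_proper; pose out i := [set f i j | j : 'I_n & (i < j)%N]%SET.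
have out_neq (i j : 'I_n) : (i < j)%N -> out i <> out j.
  move=> ij eq_out; have : f i j \in out i by apply: imset_f; rewrite inE.
  rewrite eq_out => /imsetP[l]; rewrite inE => jl; exact: f_proper.
have out_inj : injective out.
  move=> i j eq_out; apply: val_inj => /=.
  by case: (ltngtP i j) => // /out_neq []; rewrite eq_out.
by have := leq_card out out_inj; rewrite card_ord card_sets.
Qed.

(** The colours of the triples that extend a pair form a proper colouring of
    pairs, by the argument of [card_shift_pair] one level up. *)
Lemma card_shift_triple (n : nat) (T : finType)
    (f : 'I_n -> 'I_n -> 'I_n -> T) :
  (forall i j l m : 'I_n, (i < j)%N -> (j < l)%N -> (l < m)%N ->
     f i j l <> f j l m) ->
  (n <= 2 ^ (2 ^ #|T|))%N.
Proof.
move=> f_proper; rewrite -card_sets.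
pose out i j := [set f i j l | l : 'I_n & (j < l)%N]%SET.
apply: (@card_shift_pair _ _ out) => i j l ij jl eq_out.
have : f i j l \in out i j by apply: imset_f; rewrite inE.
rewrite eq_out => /imsetP[m]; rewrite inE => lm; exact: f_proper.
Qed.

End ShiftGraphs.

(** * Rays issuing from a hole *)

Section Rays.
Variable R : realType.

Lemma near_right0P (P : R -> Prop) :
  (\forall t \near 0^'+, P t) <->
  exists2 e : R, 0 < e & forall t, 0 < t -> t < e -> P t.
Proof.
split=> [|[e e0 eP]].
  move=> [e /= e0 eP]; exists e => // t t0 te; apply: eP => //=.
  by rewrite sub0r normrN gtr0_norm.
near=> t; apply: eP; near: t; first exact: nbhs_right_gt.
exact: nbhs_right_lt.
Unshelve. all: by end_near. Qed.

(** Every smallness condition in the construction of a transversal line is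
    affine in the perturbation parameter, so this is the only limit needed
    there. *)
Lemma affine_gt0_near (a b : R) : 0 < a -> \forall s \near 0^'+, 0 < a + s * b.
Proof.
move=> a0; apply/near_right0P; have b0 : 0 < `|b| + 1 by rewrite ltr_pwDr.
exists (a / (`|b| + 1)); first exact: divr_gt0.
move=> s s0; rewrite ltr_pdivlMr // => sab.
have : - (s * b) <= s * `|b| by rewrite -mulrN ler_pM2l // -normrN ler_norm.
lra.
Qed.

Variables (d : nat) (X : set 'rV[R]_d).

Lemma hole_notin (q : 'rV[R]_d) : one_point_hole X q -> ~ X q.
Proof.
move=> hole; have : path_component R (~` X) q q by rewrite hole.
by move=> [g [_ gX g0 _]]; apply: gX; exists 0 => //=; rewrite in_itv /= lexx ler01.
Qed.

(** Otherwise an initial segment of the ray would be a path in the complement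
    leaving the hole. *)
Lemma hole_ray_meets (q u : 'rV[R]_d) (e : R) : one_point_hole X q ->
  u != 0 -> 0 < e -> exists t, [/\ 0 < t, t < e & X (q + t *: u)].
Proof.
move=> hole u0 e0; apply: contrapT => noX.
have qX := hole_notin hole.
suff : path_component R (~` X) q (q + (e / 2) *: u).
  rewrite hole /= => /eqP; rewrite -subr_eq0 addrAC subrr add0r scaler_eq0.
  by rewrite (negPf u0) orbF => /eqP; lra.
exists (fun s => q + (s * (e / 2)) *: u); split.
- apply: continuous_subspaceT => s; apply: cvgD; first exact: cvg_cst.
  apply: cvgZr_tmp; apply: cvgMr_tmp; exact: cvg_id.
- move=> _ [s + <-]; rewrite /= in_itv /= => /andP[s0 s1].
  move: s0; rewrite le_eqVlt => /predU1P[<-|s0].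
    by rewrite mul0r scale0r addr0.
  move=> Xs; apply: noX; exists (s * (e / 2)); split => //; last by nra.
  by apply: mulr_gt0 => //; lra.
- by rewrite mul0r scale0r addr0.
- by rewrite mul1r.
Qed.

Lemma invisible_across (q u : 'rV[R]_d) (s t : R) : ~ X q -> 0 < s -> 0 < t ->
  ~ sees X (q - s *: u) (q + t *: u).
Proof.
move=> qX s0 t0 seen; apply: qX; apply: seen.
exists (s / (s + t)) => /=.
  rewrite in_itv /=; apply/andP; split; first by apply: divr_ge0; lra.
  by rewrite ler_pdivrMr; lra.
apply/rowP => i; rewrite !mxE; field; lra.
Qed.

(** If points outside [X] occurred arbitrarily near [q] on the ray, no colour
    could recur arbitrarily near [q]: between two occurrences one finds a
    point outside [X], which would make them invisible to each other.  Then
    each of the finitely many colours is absent near [q], so [X] is too, against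
    [hole_ray_meets]. *)
Lemma hole_ray_near (k : nat) (q u : 'rV[R]_d) :
  colorable (@invisible R d X) k -> one_point_hole X q -> u != 0 ->
  \forall t \near 0^'+, X (q + t *: u).
Proof.
move=> [c c_proper] hole u0; apply: contrapT => notX.
have hidden e : 0 < e -> exists t, [/\ 0 < t, t < e & ~ X (q + t *: u)].
  move=> e0; apply: contrapT => noX; apply: notX; apply/near_right0P.
  exists e => // t t0 te; apply: contrapT => Xt; apply: noX; by exists t.
have colour_vanishes (a : 'I_k) : \forall t \near 0^'+,
    ~ exists2 x : X, val x = q + t *: u & c x = a.
  apply: contrapT => recurs.
  have recurs' e : 0 < e -> exists t, [/\ 0 < t, t < e &
      exists2 x : X, val x = q + t *: u & c x = a].
    move=> e0; apply: contrapT => noa; apply: recurs; apply/near_right0P.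
    exists e => // t t0 te a_t; apply: noa; by exists t.
  (* Nested choices: [x] at [t], then [r < t] outside [X], then [y] at [s < r]. *)
  have [t [t0 _ [x xt cx]]] := recurs' 1 ltr01.
  have [r [r0 rt nXr]] := hidden t t0.
  have [s [s0 sr [y ys cy]]] := recurs' r r0.
  apply: (c_proper y x); last by rewrite cx cy.
  rewrite /invisible.
  have -> : val y = (q + r *: u) - (r - s) *: u.
    by rewrite ys; apply/rowP => i; rewrite !mxE; ring.
  have -> : val x = (q + r *: u) + (t - r) *: u.
    by rewrite xt; apply/rowP => i; rewrite !mxE; ring.
  apply: invisible_across => //; lra.
have [e e0 none] := (near_right0P _).1 (filter_forall _ colour_vanishes).
have [t [t0 te Xt]] := hole_ray_meets hole u0 e0.
apply: (none t t0 te (c (SigSub (mem_set Xt)))).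
by exists (SigSub (mem_set Xt)).
Qed.

End Rays.

(** * Convex position and transversal lines in the plane *)

Section Plane.
Variable R : realType.
Implicit Types u v w a b : 'rV[R]_2.

Definition cross u v : R := u 0 0 * v 0 1 - u 0 1 * v 0 0.

Lemma row2P u v : u 0 0 = v 0 0 -> u 0 1 = v 0 1 -> u = v.
Proof.
move=> uv0 uv1; apply/rowP => -[[|[|//]] lt2].
  by rewrite (_ : Ordinal lt2 = 0) //; apply: val_inj.
by rewrite (_ : Ordinal lt2 = 1) //; apply: val_inj.
Qed.

Lemma orientationE a b c : orientation a b c = cross (b - a) (c - a).
Proof. by rewrite /orientation /cross !mxE. Qed.

Lemma orientation_rot a b c : orientation a b c = orientation b c a.
Proof. by rewrite /orientation; ring. Qed.

(** Within less than a half turn to the right of [h], turning right is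
    transitive. *)
Lemma cross_trans h u v w : cross h u <= 0 -> cross h v < 0 -> cross h w < 0 ->
  cross u v < 0 -> cross v w < 0 -> cross u w < 0.
Proof.
move=> hu hv hw uv vw.
have pluecker : cross h v * cross u w =
    cross h u * cross v w + cross h w * cross u v.
  by rewrite /cross; ring.
rewrite -(nmulr_rgt0 _ hv) pluecker ltr_wpDl ?mulr_le0 ?(ltW vw) //.
by rewrite nmulr_rgt0.
Qed.

(** Seen from [q_i], the other holes lie strictly to the right of the edge
    that starts at [q_i], except for its other end, which is on it: this is
    where [cross_trans] applies.  The edge from [q_m] to [q_(m+1)] says that
    consecutive holes are seen turning right, so induction on [l] concludes. *)
Lemma convex_orientation (n : nat) (q : 'I_n -> 'rV[R]_2) (i j l : 'I_n) :
  clockwise_convex_position q -> (i < j)%N -> (j < l)%N ->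
  orientation (q i) (q j) (q l) < 0.
Proof.
move=> [_ conv] ij.
have ordS_small (m m' : 'I_n) : (m < m')%N -> val (ordS m) = m.+1.
  by move=> mm'; rewrite /= modn_small //; have := ltn_ord m'; lia.
have edge (m m' : 'I_n) : (m < m')%N -> exists s : 'I_n,
    val s = m.+1 /\ forall r : 'I_n, r != m -> r != s ->
      orientation (q m) (q s) (q r) < 0.
  by move=> mm'; exists (ordS m); split=> [|r rm rs];
     [exact: ordS_small mm'|exact: conv].
have [s [s_val s_edge]] := edge i j ij.
case: l => l ln /=; elim: l ln => // l IHl ln.
rewrite ltnS leq_eqVlt => /orP[/eqP jl|jl].
  have [t [t_val t_edge]] : exists t : 'I_n, val t = j.+1 /\ _ :=
    edge j (Ordinal ln) (eq_leq (congr1 S jl)).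
  have -> : Ordinal ln = t by apply: val_inj; rewrite /= t_val jl.
  rewrite orientation_rot; apply: t_edge; rewrite -val_eqE ?t_val /=; lia.
have ln' : (l < n)%N by lia.
have := IHl ln' jl; set m := Ordinal ln' => jm.
have [t [t_val t_edge]] := edge m (Ordinal ln) (leqnn _).
have -> : Ordinal ln = t by apply: val_inj; rewrite /= t_val.
have mt : orientation (q i) (q m) (q t) < 0.
  rewrite orientation_rot; apply: t_edge; rewrite -val_eqE ?t_val /=; lia.
move: jm mt; rewrite !orientationE => jm mt.
apply: (cross_trans (h := q s - q i)) jm mt; rewrite -!orientationE.
- have [->|js] := eqVneq j s; first by rewrite /orientation; lra.
  by apply/ltW/s_edge => //; rewrite -val_eqE /=; lia.
- by apply: s_edge; rewrite -val_eqE ?s_val /=; lia.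
- by apply: s_edge; rewrite -val_eqE ?s_val ?t_val /=; lia.
Qed.

(** The system [a + t *: u = a + D - r *: (D - s *: N)] in the unknowns [t]
    and [r], solved by Cramer's rule. *)
Lemma crossing_point (a D N u : 'rV[R]_2) (A B E s : R) :
  B + s * E != 0 -> A *: u = E *: D + B *: N ->
  a + (s * A / (B + s * E)) *: u = a + D - (B / (B + s * E)) *: (D - s *: N).
Proof.
move=> den_neq0 Au; rewrite (mulrAC s) -(scalerA (s / _)) Au.
apply/rowP => k; rewrite !mxE; field; exact: den_neq0.
Qed.

(** Rotate the line through [a] and [b] slightly about [b], towards the side
    of [a] on which all the rays [a + t *: u i] leave.  It then crosses each of
    these rays close to [a], inside [X], while the points [r j] strictly on
    the right of the line stay there. *)
Lemma ex_transversal_line (X : set 'rV[R]_2) (a b : 'rV[R]_2) (I J : finType)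
    (u : I -> 'rV[R]_2) (r : J -> 'rV[R]_2) (P : pred I) (Q : pred J) : a != b ->
  (forall i, P i -> cross (u i) (b - a) < 0) ->
  (forall i, P i -> \forall t \near 0^'+, X (a + t *: u i)) ->
  (forall j, Q j -> cross (b - a) (r j - b) < 0) ->
  exists v, (forall j, Q j -> cross v (r j - b) < 0) /\
    forall i, P i -> exists t s, [/\ 0 < t, 0 < s,
      a + t *: u i = b - s *: v & X (a + t *: u i)].
Proof.
move=> ab u_left u_ray r_right; pose D := b - a.
(* [N] is [D] turned left by a right angle; the line joins [a + s *: N] to [b]. *)
pose N : 'rV[R]_2 := \row_k (if k == 0 then - D 0 1 else D 0 0).
(* [A *: u i = E i *: D + B i *: N] in the orthogonal frame [D], [N]. *)
pose A := D 0 0 ^+ 2 + D 0 1 ^+ 2.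
pose B i := - cross (u i) D.
pose E i := u i 0 0 * D 0 0 + u i 0 1 * D 0 1.
have A0 : 0 < A.
  rewrite lt_neqAle eq_sym addr_ge0 ?sqr_ge0 // andbT.
  rewrite paddr_eq0 ?sqr_ge0 // !sqrf_eq0.
  apply: contraNN ab => /andP[/eqP D0 /eqP D1].
  move: D0 D1; rewrite !mxE => D0 D1.
  by apply/eqP/row2P; lra.
have right_near j : \forall s \near 0^'+, Q j -> cross (D - s *: N) (r j - b) < 0.
  have [Qj|_] := boolP (Q j); last by near=> s.
  have := r_right j Qj; rewrite -oppr_gt0 => /(affine_gt0_near (cross N (r j - b))).
  apply: filterS => s + _; rewrite -/D /cross !mxE; lra.
have hit_near i : \forall s \near 0^'+, P i -> exists t s', [/\ 0 < t, 0 < s',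
    a + t *: u i = b - s' *: (D - s *: N) & X (a + t *: u i)].
  have [Pi|_] := boolP (P i); last by near=> s.
  have Bi : 0 < B i by rewrite oppr_gt0; exact: u_left.
  have [e e0 eX] := (near_right0P _).1 (u_ray i Pi).
  have den_near := affine_gt0_near (E i) Bi.
  have small_near := affine_gt0_near (e * E i - A) (mulr_gt0 e0 Bi).
  near=> s => _.
  have s0 : 0 < s by near: s; exact: nbhs_right_gt.
  have den0 : 0 < B i + s * E i by near: s.
  have small : 0 < e * B i + s * (e * E i - A) by near: s.
  have t0 : 0 < s * A / (B i + s * E i) by rewrite !(divr_gt0, mulr_gt0).
  exists (s * A / (B i + s * E i)), (B i / (B i + s * E i)); split => //.
  - exact: divr_gt0.
  - have -> : b = a + D by rewrite addrC subrK.
    have den_neq0 : B i + s * E i != 0 by rewrite gt_eqF.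
    apply: crossing_point => //.
    by apply: row2P; rewrite !mxE /= /A /E /B /cross !mxE; ring.
  - by apply: eX => //; rewrite ltr_pdivrMr //; nra.
have right_all := filter_forall _ right_near.
have hit_all := filter_forall _ hit_near.
near (0 : R)^'+ => s.
exists (D - s *: N); split; [near: s; exact: right_all|near: s; exact: hit_all].
Unshelve. all: by end_near. Qed.

Lemma cross_neq0 u v : cross u v < 0 -> u != 0.
Proof. by apply: contraTneq => ->; rewrite /cross !mxE !mul0r subrr ltxx. Qed.

(** The direction [v j l] has to be adapted to all the rays directed by [v i j]
    with [i < j], so the rows [v j] are built by induction on [j].  The
    induction also maintains that the points of higher index than [l] lie on
    the right of the direction [v j l] at [q_l]: this is what puts the rays on
    the correct side for the later rows. *)
Lemma ex_transversal_system (X : set 'rV[R]_2) (k n : nat)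
    (q : 'I_n -> 'rV[R]_2) :
  colorable (@invisible R 2 X) k -> (forall i, one_point_hole X (q i)) ->
  injective q ->
  (forall i j l : 'I_n, (i < j)%N -> (j < l)%N ->
     orientation (q i) (q j) (q l) < 0) ->
  exists v : 'I_n -> 'I_n -> 'rV[R]_2,
    forall i j l : 'I_n, (i < j)%N -> (j < l)%N -> exists t s,
      [/\ 0 < t, 0 < s, q j + t *: v i j = q l - s *: v j l &
        X (q j + t *: v i j)].
Proof.
move=> colX hole q_inj q_conv.
pose good (v : 'I_n -> 'I_n -> 'rV[R]_2) (j : 'I_n) := forall l : 'I_n,
  (j < l)%N ->
  (forall m : 'I_n, (l < m)%N -> cross (v j l) (q m - q l) < 0) /\
  forall i : 'I_n, (i < j)%N -> exists t s,
    [/\ 0 < t, 0 < s, q j + t *: v i j = q l - s *: v j l &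
      X (q j + t *: v i j)].
suff /(_ n)[v v_good] : forall m, exists v : 'I_n -> 'I_n -> 'rV[R]_2,
    forall j : 'I_n, (j < m)%N -> good v j.
  by exists v => i j l ij jl; apply: (v_good j (ltn_ord j) l jl).2.
elim=> [|m [v v_good]]; first by exists (fun _ _ => 0).
have [mn|nm] := ltnP m n; last first.
  exists v => j _; apply: v_good; exact: leq_trans (ltn_ord j) nm.
pose jm := Ordinal mn.
have row (l : 'I_n) : exists w : 'rV[R]_2, (jm < l)%N ->
    (forall r : 'I_n, (l < r)%N -> cross w (q r - q l) < 0) /\
    forall i : 'I_n, (i < jm)%N -> exists t s,
      [/\ 0 < t, 0 < s, q jm + t *: v i jm = q l - s *: w &
        X (q jm + t *: v i jm)].
  have [jl|_] := ltnP jm l; last by exists 0.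
  have v_right (i : 'I_n) : (i < jm)%N -> cross (v i jm) (q l - q jm) < 0.
    move=> ij; exact: (v_good i ij jm ij).1.
  have [|//|i ij||w [w_right w_hit]] := @ex_transversal_line X (q jm) (q l)
      'I_n 'I_n (v^~ jm) q (fun i => (i < jm)%N) (fun r => (l < r)%N).
  - by apply: contraTneq jl => /q_inj ->; rewrite ltnn.
  - exact: (hole_ray_near colX (hole jm) (cross_neq0 (v_right i ij))).
  - move=> r lr; have := q_conv jm l r jl lr; congr (_ < 0).
    by rewrite /orientation /cross !mxE; ring.
  - by exists w.
have [w w_row] := choice row.
exists (fun j l => if j == jm then w l else v j l) => j.
have [-> _|j_neq] := eqVneq j jm.
  move=> l jl; rewrite eqxx; have [w_right w_hit] := w_row l jl.
  split=> // i ij; have -> : (i == jm) = false by rewrite -val_eqE ltn_eqF.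
  exact: w_hit.
rewrite ltnS leq_eqVlt -[X in X || _]/(j == jm) (negPf j_neq) /= => jm_lt l jl.
rewrite (negPf j_neq); have [v_right v_hit] := v_good j jm_lt l jl.
split=> // i ij; have -> : (i == jm) = false.
  by rewrite -val_eqE ltn_eqF // (ltn_trans ij).
exact: v_hit.
Qed.

End Plane.

(** * The bound on the number of holes *)

Theorem lemma6 (R : realType) (X : set 'rV[R]_2) (n : nat)
    (q : 'I_n -> 'rV[R]_2)
    (hole_q : forall i : 'I_n, one_point_hole X (q i))
    (convex_q : clockwise_convex_position q) :
  leq_ext n (omap (tower 2) (chi X)).
Proof.
rewrite /chi /chromatic_number; case: pselect => //= h.
case: ex_minnP => k /asboolP colX _.
case: (posnP n) => [->//|n0].
have [v v_hit] := ex_transversal_system colX hole_q convex_q.1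
  (fun i j l => @convex_orientation R n q i j l convex_q).
(* The triples that are not increasing need a dummy point of [X]. *)
have u0 : const_mx 1 != 0 :> 'rV[R]_2.
  by apply/eqP => /rowP/(_ 0)/eqP; rewrite !mxE oner_eq0.
have [t0 [_ _ Xx0]] := hole_ray_meets (hole_q (Ordinal n0)) u0 ltr01.
pose x0 : X := SigSub (mem_set Xx0).
have point (z : 'I_n * 'I_n * 'I_n) : exists x : X, let: (i, j, l) := z in
    (i < j)%N -> (j < l)%N -> exists t s, [/\ 0 < t, 0 < s,
      val x = q j + t *: v i j & val x = q l - s *: v j l].
  case: z => [[i j] l]; case: (ltnP i j) => [ij|_]; last by exists x0.
  case: (ltnP j l) => [jl|_]; last by exists x0.
  have [t [s [t_gt0 s_gt0 e Xp]]] := v_hit i j l ij jl.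
  by exists (SigSub (mem_set Xp)) => _ _; exists t, s.
have [p pP] := choice point.
have [c c_proper] := colX.
rewrite -(card_ord k).
apply: (@card_shift_triple _ _ (fun i j l => c (p (i, j, l)))) => i j l m ij jl lm.
apply: c_proper; rewrite /invisible.
have [_ [s [_ s0 _ ->]]] := pP (i, j, l) ij jl.
have [t [_ [t_gt0 _ -> _]]] := pP (j, l, m) jl lm.
by apply: invisible_across => //; exact: hole_notin.
Qed.
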